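(* Let $n,\ell\ge1$ and let $k=(k_1,\dots,k_\ell)$ be a partition of $n$. Every symbol of the type $t^p$ on $\mathbb{P}^n(\mathbb{C})$, with $p\in\mathbb{Z}^n$ such that $|p_{(j)}|=0$ for every $j=1,\dots,\ell$, belongs to $\pi_k^*\big(L^\infty\big(\prod_{j=1}^\ell\mathbb{P}^{k_j-1}(\mathbb{C})\big)\big)$. More precisely, $$\{t^p : p\in\mathbb{Z}^n,\ |p_{(j)}|=0\text{ for every }j=1,\dots,\ell\}\subset\Big\{f\circ\pi_k : f\in L^\infty\Big(\prod_{j=1}^\ell\mathbb{P}^{k_j-1}(\mathbb{C})\Big)\Big\}.$$
   Context: A partition of $n$ is $k=(k_1,\dots,k_\ell)$ with integers $k_j\ge1$, $k_1+\dots+k_\ell=n$. It decomposes $w\in\mathbb{C}^{n+1}$ as $w=(w_0,w_{(1)},\dots,w_{(\ell)})$ with $w_0\in\mathbb{C}$ and $w_{(j)}=(w_{j,1},\dots,w_{j,k_j})\in\mathbb{C}^{k_j}$ consecutive blocks; multi-indices $p\in\mathbb{Z}^n$ are split likewise into $p_{(1)},\dots,p_{(\ell)}$, and $|p_{(j)}|$ is the sum of the entries of $p_{(j)}$. Put $t_{j,l}=w_{j,l}/|w_{j,l}|$ (defined a.e.) and $t_{(j)}^{p_{(j)}}=\prod_{l=1}^{k_j}t_{j,l}^{p_{j,l}}$. When $|p_{(j)}|=0$ for all $j$, the symbol $t^p$ is the (a.e. well-defined) function $[w]\mapsto t^p=\prod_{j=1}^\ell t_{(j)}^{p_{(j)}}$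 on $\mathbb{P}^n(\mathbb{C})$. $\pi_k$ is the map $\pi_k([w])=([w_{(1)}],\dots,[w_{(\ell)}])\in\prod_{j=1}^\ell\mathbb{P}^{k_j-1}(\mathbb{C})$, defined on the open dense, full-measure subset of $\mathbb{P}^n(\mathbb{C})$ where all $w_{(j)}\ne0$. Functions are identified when equal almost everywhere (with respect to the natural smooth measures). *)

(* Defs.v *)
From HB Require Import structures.
From mathcomp Require Import all_boot all_order all_algebra.
From mathcomp Require Import all_classical all_reals all_analysis.
From mathcomp.real_closed Require Import complex.

Set Implicit Arguments.
Unset Strict Implicit.
Unset Printing Implicit Defensive.

Import Order.TTheory GRing.Theory Num.Theory.
Import numFieldNormedType.Exports.
Import ComplexField.

Local Open Scope classical_set_scope.
Local Open Scope ring_scope.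
Local Open Scope complex_scope.
Local Open Scope quotient_scope.

Definition dprod_display (d : measure_display) : measure_display.
Proof. exact: d. Qed.

Definition dprod n (T : 'I_n -> Type) : Type := forall i, T i.

Section dprod_measurable.
Context {d : measure_display} {n : nat} (T : 'I_n -> measurableType d).

HB.instance Definition _ := gen_eqMixin (dprod T).
HB.instance Definition _ := gen_choiceMixin (dprod T).
HB.instance Definition _ := isPointed.Build (dprod T) (fun i => point).

Definition dprod_cylinder : set (set (dprod T)) :=
  [set A | exists i (B : set (T i)), measurable B /\ A = [set f | B (f i)]].

HB.instance Definition _ := @isMeasurable.Build (dprod_display d) (dprod T)
  <<s dprod_cylinder >> (@sigma_algebra0 _ setT _) (@sigma_algebraC _ _)
  (@sigma_algebra_bigcup _ setT _).

Lemma measurable_dproj i :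
  measurable_fun [set: dprod T] (fun f : dprod T => f i).
Proof.
by move=> _ B mB; rewrite setTI; apply: sub_sigma_algebra; exists i, B.
Qed.

Lemma measurable_fun_dprodP d' (X : measurableType d') (g : X -> dprod T) :
  (forall i, measurable_fun [set: X] (fun x => g x i)) ->
  measurable_fun [set: X] g.
Proof.
move=> mg _ A mA.
have : <<s dprod_cylinder >> `<=` image_set_system setT g measurable.
  apply: smallest_sub.
    exact/sigma_algebra_image/sigma_algebra_measurable.
  by move=> _ [i [B [mB ->]]]; exact: (mg i).
exact.
Qed.

End dprod_measurable.

Section dcons.
Context {n : nat} (T : 'I_n.+1 -> Type).

Definition dcons (x : T ord0) (f : dprod (fun j => T (lift ord0 j))) :
    dprod T :=
  fun i => match unliftP ord0 i with
  | UnliftSome j e => ecast i (T i) (esym e) (f j)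
  | UnliftNone e => ecast i (T i) (esym e) x
  end.

Lemma dcons0 x f : dcons x f ord0 = x.
Proof.
rewrite /dcons; case: unliftP => [j e|e]; first by have := congr1 val e.
by rewrite eq_axiomK.
Qed.

Lemma dconsS x f j : dcons x f (lift ord0 j) = f j.
Proof.
rewrite /dcons; case: unliftP => [j' e|e]; last by have := congr1 val e.
have ej := lift_inj e; move: e; rewrite -ej => e.
by rewrite eq_axiomK.
Qed.

End dcons.

Section dprod_probability.
Context {d : measure_display} {R : realType}.

Section cons_mfun.
Context {n : nat} (T : 'I_n.+1 -> measurableType d).

Definition dcons_pair (xf : T ord0 * dprod (fun j => T (lift ord0 j))) :
  dprod T := dcons xf.1 xf.2.

Lemma measurable_dcons_pair : measurable_fun setT dcons_pair.
Proof.
apply: measurable_fun_dprodP => i; case: (unliftP ord0 i) => [j|] ->.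
  rewrite (_ : (fun _ => _) =
     (fun f : dprod (fun j => T (lift ord0 j)) => f j) \o snd); last first.
    by apply/funext => xf; rewrite /dcons_pair dconsS.
  by apply: measurableT_comp => //; exact: measurable_dproj.
by rewrite (_ : (fun _ => _) = fst)//; apply/funext => xf; exact: dcons0.
Qed.

HB.instance Definition _ :=
  isMeasurableFun.Build _ _ _ _ dcons_pair measurable_dcons_pair.

End cons_mfun.

(* The product probability measure, i.e. the only one satisfying the rectangle
   formula dprod_probE. *)
Fixpoint dprod_prob (n : nat) : forall T : 'I_n -> measurableType d,
    (forall i, probability (T i) R) -> probability (dprod T) R :=
  match n with
  | 0 => fun T P => \d_(point : dprod T)
  | m.+1 => fun T P =>
      distribution (P ord0 \x dprod_prob (fun j => P (lift ord0 j)))%E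
        (@dcons_pair m T)
  end.

Lemma dprod_probE n (T : 'I_n -> measurableType d)
    (P : forall i, probability (T i) R) (A : forall i, set (T i)) :
  (forall i, measurable (A i)) ->
  dprod_prob P [set f | forall i, A i (f i)] = (\prod_i P i (A i))%E.
Proof.
elim: n T P A => [|n IH] T P A mA.
  rewrite big_ord0 /= diracE mem_set//= => -[] //.
rewrite big_ord_recl /= /distribution /pushforward.
rewrite (_ : _ @^-1` _ = A ord0 `*` [set f | forall j, A (lift ord0 j) (f j)]);
    last first.
  apply/seteqP; split => -[x f] /=.
    move=> h; split; first by have := h ord0; rewrite /dcons_pair dcons0.
    by move=> j; have := h (lift ord0 j); rewrite /dcons_pair dconsS.
  move=> [Ax Af] i; case: (unliftP ord0 i) => [j|] ->.
    by rewrite /dcons_pair dconsS; exact: Af.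
  by rewrite /dcons_pair dcons0.
rewrite product_measure1E//; first by congr (_ * _)%E; exact: (IH _ (fun j => P (lift ord0 j)) (fun j => A (lift ord0 j)) (fun j => mA _)).
rewrite (_ : [set _ | _] = \bigcap_(j in [set: 'I_n])
  (fun f : dprod (fun j => T (lift ord0 j)) => f j) @^-1` A (lift ord0 j));
    last first.
  by apply/seteqP; split => f /= h j; [move=> _|]; exact: h.
apply: fin_bigcap_measurable => // j _.
rewrite -[X in measurable X]setTI.
exact: (@measurable_dproj _ _ (fun j => T (lift ord0 j)) j measurableT _ (mA _)).
Qed.

End dprod_probability.

Section complex_measurable.
Context {R : realType}.

Definition complex_display : measure_display. Proof. exact: default_measure_display. Qed.

Local Notation Rm := (measurableTypeR R).

Definition RI (z : R[i]) : Rm * Rm := (complex.Re z, complex.Im z).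

HB.instance Definition _ := isPointed.Build R[i] 0.

HB.instance Definition _ := @isMeasurable.Build complex_display R[i]
  (g_sigma_algebra_preimage RI)
  (@measurable0 _ (g_sigma_algebra_preimageType RI))
  (@measurableC _ (g_sigma_algebra_preimageType RI))
  (@bigcupT_measurable _ (g_sigma_algebra_preimageType RI)).

Definition ofRI (xy : Rm * Rm) : R[i] := xy.1 +i* xy.2.

Lemma measurable_ofRI : measurable_fun setT ofRI.
Proof.
move=> _ _ [B mB <-]; rewrite !setTI -comp_preimage.
by rewrite (_ : _ \o _ = id)//; apply/funext => -[].
Qed.

HB.instance Definition _ := isMeasurableFun.Build _ _ _ _ ofRI measurable_ofRI.

(* Law of X + iY with X, Y independent N(0, 1). *)
Definition gaussC : probability R[i] R :=
  distribution (normal_prob (0 : R) 1 \x normal_prob (0 : R) 1)%E ofRI.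

End complex_measurable.

Section projective_space.
Context (R : realType) (n : nat).

Definition nzvec : Type := {w : 'rV[R[i]]_n.+1 | w != 0}.

HB.instance Definition _ := Choice.on nzvec.

Definition colinear (u v : nzvec) : bool :=
  `[< exists2 c : R[i], c != 0 & val u = c *: val v >].

Lemma colinear_refl : reflexive colinear.
Proof. by move=> u; apply/asboolP; exists 1; rewrite ?oner_neq0// scale1r. Qed.

Lemma colinear_sym : symmetric colinear.
Proof.
move=> u v; apply/idP/idP => /asboolP[c c0 e]; apply/asboolP;
  by exists c^-1; rewrite ?invr_neq0// e scalerA mulVf// scale1r.
Qed.

Lemma colinear_trans : transitive colinear.
Proof.
move=> v u w /asboolP[c c0 e] /asboolP[c' c'0 e']; apply/asboolP.
by exists (c * c'); rewrite ?mulf_neq0// e e' scalerA.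
Qed.

Canonical colinear_equiv :=
  EquivRel colinear colinear_refl colinear_sym colinear_trans.

(* P^n(C), the lines of C^(n+1). *)
Definition projspace : Type := {eq_quot colinear_equiv}.

HB.instance Definition _ := Choice.on projspace.
HB.instance Definition _ := Quotient.on projspace.

Fact nzvec1_subproof : const_mx 1 != 0 :> 'rV[R[i]]_n.+1.
Proof.
apply/eqP => /matrixP/(_ ord0 ord0); rewrite !mxE => /eqP.
by rewrite oner_eq0.
Qed.

Definition nzvec1 : nzvec :=
  exist (fun w : 'rV[R[i]]_n.+1 => w != 0) _ nzvec1_subproof.

HB.instance Definition _ := isPointed.Build projspace (\pi_projspace nzvec1).

(* [w], with a junk value at w = 0. *)
Definition class_of (w : 'rV[R[i]]_n.+1) : projspace :=
  \pi_projspace (insubd nzvec1 w).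

(* Homogeneous coordinates of x. *)
Definition hcoord (x : projspace) : 'rV[R[i]]_n.+1 := val (repr x).

Lemma hcoord_neq0 x : hcoord x != 0.
Proof. exact: (valP (repr x)). Qed.

Lemma hcoordK x : class_of (hcoord x) = x.
Proof. by rewrite /class_of /hcoord valKd reprK. Qed.

Lemma class_ofK w : w != 0 ->
  exists2 c, c != 0 & hcoord (class_of w) = c *: w.
Proof.
move=> w0; have /eqP := reprK (class_of w).
rewrite [X in _ == X]/class_of => /eqP/eqmodP/asboolP[c c0 e].
by exists c => //; rewrite /hcoord e val_insubd w0.
Qed.

Lemma class_ofZ c w : c != 0 -> class_of (c *: w) = class_of w.
Proof.
move=> c0; have [->|w0] := eqVneq w 0; first by rewrite scaler0.
apply/eqmodP/asboolP; exists c => //.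
by rewrite !val_insubd scaler_eq0 (negbTE c0) (negbTE w0).
Qed.

End projective_space.

Section projective_measure.
Context (R : realType) (n : nat).

Local Notation vec := (dprod (fun _ : 'I_n.+1 => R[i])).

Definition class_of_vec (z : vec) : projspace R n :=
  class_of (\row_i z i).

Definition proj_display : measure_display.
Proof. exact: default_measure_display. Qed.

Let image_sigma := sigma_algebra_image class_of_vec
  (@sigma_algebra_measurable _ vec).

Let image_setC A : image_set_system setT class_of_vec measurable A ->
  image_set_system setT class_of_vec measurable (~` A).
Proof. by move=> mA; rewrite -setTD; case: image_sigma => _ + _; exact. Qed.

(* A set of lines is measurable when their union is measurable in C^(n+1); this
   is also the Borel sigma-algebra of the quotient topology, as C^(n+1) \ 0 -> P^n
   has continuous local sections. *)
HB.instance Definition _ := @isMeasurable.Build proj_display (projspace R n)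
  (image_set_system setT class_of_vec measurable)
  (let: And3 h _ _ := image_sigma in h) image_setC
  (let: And3 _ _ h := image_sigma in h).

Lemma measurable_class_of_vec : measurable_fun setT class_of_vec.
Proof. by []. Qed.

HB.instance Definition _ :=
  isMeasurableFun.Build _ _ _ _ class_of_vec measurable_class_of_vec.

(* The Fubini-Study volume, normalized: the image of the standard Gaussian of
   C^(n+1), which is the unitarily invariant probability measure on P^n(C). *)
Definition fubini_study : probability (projspace R n) R :=
  distribution (dprod_prob (fun _ : 'I_n.+1 => @gaussC R)) class_of_vec.

End projective_measure.

Record npartition (n l : nat) := NPartition {
  part :> 'I_l -> nat;
  part_gt0 : forall j, (0 < part j)%N;
  part_sum : (\sum_(j < l) part j)%N = n
}.

Section blocks.
Context {n l : nat} (k : npartition n l).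

(* The position in 'I_n of the i-th entry of the j-th consecutive block. *)
Definition block_index j (i : 'I_(k j)) : 'I_n :=
  cast_ord (part_sum k) (tagnat.Rank j i).

Lemma block_indexE j (i : 'I_(k j)) :
  block_index i = (\sum_(j' < l | j' < j) k j' + i)%N :> nat.
Proof. exact: tagnat.RankEsum. Qed.

Definition block {A : Type} (v : 'rV[A]_n) j : 'rV[A]_(k j) :=
  colsub (@block_index j) v.

End blocks.

Section symbols.
Context {R : realType} {n l : nat} (k : npartition n l).

(* w_(j), for w = (w_0, w_(1), ..., w_(l)). *)
Definition wblock (w : 'rV[R[i]]_n.+1) j : 'rV[R[i]]_(k j) :=
  block k (col' ord0 w) j.

(* [v] in P^(m-1)(C), for v a vector of C^m. *)
Definition class_of_pred m (m_gt0 : (0 < m)%N) (v : 'rV[R[i]]_m) :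
    projspace R m.-1 :=
  class_of (castmx (erefl 1%N, esym (prednK m_gt0)) v).

Definition pi_dom : set (projspace R n) :=
  [set x | forall j, wblock (hcoord x) j != 0].

Definition pi_k (x : projspace R n) : dprod (fun j => projspace R (k j).-1) :=
  fun j => class_of_pred (part_gt0 k j) (wblock (hcoord x) j).

(* z / |z|, which is 0 at z = 0: t^p thus has junk values on the null set of
   points with a vanishing coordinate. *)
Definition phase (z : R[i]) : R[i] := z / `|z|.

Definition tpow (p : 'rV[int]_n) (w : 'rV[R[i]]_n.+1) : R[i] :=
  \prod_(j < l) \prod_(i < k j) phase (wblock w j ord0 i) ^ block k p j ord0 i.

Definition symbol (p : 'rV[int]_n) (x : projspace R n) : R[i] :=
  tpow p (hcoord x).

Definition balanced : set 'rV[int]_n :=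
  [set p | forall j, \sum_(i < k j) block k p j ord0 i = 0].

(* pi_dom, pi_k and symbol do not depend on the homogeneous coordinates. *)

Lemma wblockZ c (w : 'rV[R[i]]_n.+1) j : wblock (c *: w) j = c *: wblock w j.
Proof. by apply/rowP => i; rewrite !mxE. Qed.

Lemma pi_domE w : w != 0 ->
  pi_dom (class_of w) <-> (forall j, wblock w j != 0).
Proof.
move=> /class_ofK[c c0 e]; rewrite /pi_dom /= e.
by split => h j; have := h j; rewrite wblockZ scaler_eq0 (negbTE c0).
Qed.

Lemma pi_kE w : w != 0 ->
  pi_k (class_of w) = fun j => class_of_pred (part_gt0 k j) (wblock w j).
Proof.
move=> /class_ofK[c c0 e]; apply: functional_extensionality_dep => j.
rewrite /pi_k e wblockZ /class_of_pred -[RHS](class_ofZ _ c0).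
by congr class_of; apply/rowP => i; rewrite !(castmxE, mxE).
Qed.

Lemma phase_neq0 z : z != 0 -> phase z != 0.
Proof. by move=> z0; rewrite mulf_neq0// invr_neq0// normr_eq0. Qed.

Lemma phaseM : {morph phase : x y / x * y}.
Proof. by move=> x y; rewrite /phase normrM invfM mulrACA. Qed.

Lemma symbolE p w : w != 0 -> balanced p -> symbol p (class_of w) = tpow p w.
Proof.
move=> /class_ofK[c c0 e] bp; rewrite /symbol e /tpow; apply: eq_bigr => j _.
under eq_bigr do rewrite wblockZ mxE phaseM expfzMl.
rewrite big_split /= -[RHS]mul1r; congr (_ * _).
have expS (s : seq 'I_(k j)) (F : 'I_(k j) -> int) :
    \prod_(i <- s) phase c ^ F i = phase c ^ (\sum_(i <- s) F i).
  elim: s => [|i s IH]; first by rewrite !big_nil expr0z.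
  by rewrite !big_cons IH expfzDr// phase_neq0.
by rewrite expS bp expr0z.
Qed.

End symbols.

Definition Linfty d (T : measurableType d) (R : realType)
    (mu : {measure set T -> \bar R}) : set (T -> R[i]) :=
  [set f | measurable_fun setT f /\
           ('N[mu]_+oo[EFin \o (@Normc.normc R \o f)] < +oo)%E].

(* The functions equal almost everywhere to f \o pi_k for some f in L^oo; in
   particular pi_k has to be defined almost everywhere. *)
Definition pullback_Linfty (R : realType) (n l : nat) (k : npartition n l) :
    set (projspace R n -> R[i]) :=
  [set g | exists2 f,
     Linfty (dprod_prob (fun j => fubini_study R (k j).-1)) f &
     \forall x \ae fubini_study R n, pi_dom k x /\ g x = f (pi_k k x)].

(* Main.v *)
(* Rescaling a block w_(j) by c <> 0 multiplies t_(j)^p_(j) by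
   (c/|c|)^|p_(j)| = 1, so this factor is a measurable function of [w_(j)],
   bounded by 1. With f the product of these functions, t^p = f \o pi_k wherever
   pi_k is defined, and the excluded set is null because it lies in a finite
   union of coordinate hyperplanes. *)

Require Import Defs.
From mathcomp Require Import all_boot all_order all_algebra.
From mathcomp Require Import all_classical all_reals all_analysis.
From mathcomp Require Import measurable_realfun ess_sup_inf.
From mathcomp.real_closed Require Import complex.

Import Order.TTheory GRing.Theory Num.Theory.
Import ComplexField.

Local Open Scope classical_set_scope.
Local Open Scope ring_scope.
Local Open Scope complex_scope.
Local Open Scope quotient_scope.

(** * Measurability of complex-valued functions *)

Section complex_measurability.
Context {d : measure_display} {T : measurableType d} {R : realType}.
Implicit Types f g : T -> R[i].

(** The sigma-algebra of [R[i]] is pulled back from the plane along [RI], so [f] can be traded for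
    [RI \o f], a map into a product. *)
Lemma measurable_fun_complexP f :
  measurable_fun setT f <->
  measurable_fun setT (fun x => complex.Re (f x)) /\
  measurable_fun setT (fun x => complex.Im (f x)).
Proof.
have RIE : measurable_fun setT f <-> measurable_fun setT (@RI R \o f).
  split=> [mf _ B mB|mf _ _ [B mB <-]]; rewrite !setTI.
    rewrite comp_preimage -[X in measurable X]setTI; apply: mf => //.
    by exists B => //; rewrite setTI.
  rewrite -comp_preimage -[X in measurable X]setTI; exact: mf.
by rewrite RIE; exact: measurable_fun_pairP.
Qed.

Lemma measurable_funMC f g : measurable_fun setT f -> measurable_fun setT g ->
  measurable_fun setT (fun x => f x * g x).
Proof.
move=> /measurable_fun_complexP[fR fI] /measurable_fun_complexP[gR gI].
apply/measurable_fun_complexP; split.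
  rewrite (_ : (fun _ => _) = fun x =>
    complex.Re (f x) * complex.Re (g x) - complex.Im (f x) * complex.Im (g x)).
    by apply: measurable_funB; exact: measurable_funM.
  by apply/funext => x; case: (f x) (g x) => ? ? [? ?].
rewrite (_ : (fun _ => _) = fun x =>
  complex.Re (f x) * complex.Im (g x) + complex.Im (f x) * complex.Re (g x)).
  by apply: measurable_funD; exact: measurable_funM.
by apply/funext => x; case: (f x) (g x) => ? ? [? ?].
Qed.

(** On nonnegative reals inversion is the measurable power function of exponent -1; at 0 both take
    the value 0. *)
Lemma measurable_funV_ge0 (h : T -> R) : (forall x, 0 <= h x) ->
  measurable_fun setT h -> measurable_fun setT (fun x => (h x)^-1).
Proof.
move=> h0 mh; rewrite (_ : (fun _ => _) = fun x => h x `^ (- 1)).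
  exact: measurableT_comp (measurable_powR _) mh.
by apply/funext => x; rewrite powR_inv1.
Qed.

Let sqnorm_measurable f : measurable_fun setT f ->
  measurable_fun setT (fun x => complex.Re (f x) ^+ 2 + complex.Im (f x) ^+ 2).
Proof.
move=> /measurable_fun_complexP[fR fI].
by apply: measurable_funD; exact: measurable_funX.
Qed.

(** Uses [(a + ib)^-1 = (a - ib) / (a^2 + b^2)], which persists at 0, where both sides are 0. *)
Lemma measurable_funVC f : measurable_fun setT f ->
  measurable_fun setT (fun x => (f x)^-1).
Proof.
move=> mf; have [fR fI] := (measurable_fun_complexP f).1 mf.
have mV : measurable_fun setT
    (fun x => (complex.Re (f x) ^+ 2 + complex.Im (f x) ^+ 2)^-1).
  apply: measurable_funV_ge0; last exact: sqnorm_measurable.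
  by move=> x; rewrite addr_ge0 ?sqr_ge0.
apply/measurable_fun_complexP; split.
  rewrite (_ : (fun _ => _) = fun x => complex.Re (f x) *
    (complex.Re (f x) ^+ 2 + complex.Im (f x) ^+ 2)^-1).
    exact: measurable_funM.
  by apply/funext => x; case: (f x).
rewrite (_ : (fun _ => _) = fun x => - (complex.Im (f x) *
  (complex.Re (f x) ^+ 2 + complex.Im (f x) ^+ 2)^-1)).
  by apply: measurableT_comp; [exact: oppr_measurable|exact: measurable_funM].
by apply/funext => x; case: (f x).
Qed.

Lemma measurable_fun_normC f : measurable_fun setT f ->
  measurable_fun setT (fun x => `|f x|).
Proof.
(* The norm is itself a complex number with zero imaginary part; its real part is a square root,
   written below as a power 1/2. *)
move=> mf; apply/measurable_fun_complexP; split; last exact: measurable_cst.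
rewrite (_ : (fun _ => _) = fun x =>
  (complex.Re (f x) ^+ 2 + complex.Im (f x) ^+ 2) `^ 2^-1).
  by apply: measurableT_comp (measurable_powR _) _; exact: sqnorm_measurable.
apply/funext => x; rewrite powR12_sqrt ?addr_ge0 ?sqr_ge0//.
by case: (f x).
Qed.

Lemma measurable_fun_phase f : measurable_fun setT f ->
  measurable_fun setT (fun x => phase (f x)).
Proof.
move=> mf; apply: measurable_funMC => //.
by apply: measurable_funVC; exact: measurable_fun_normC.
Qed.

Lemma measurable_fun_expzC f (m : int) : measurable_fun setT f ->
  measurable_fun setT (fun x => f x ^ m).
Proof.
move=> mf; have mX q : measurable_fun setT (fun x => f x ^+ q).
  elim: q => [|q IH]; first exact: measurable_cst.
  rewrite (_ : (fun _ => _) = fun x => f x * f x ^+ q).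
    exact: measurable_funMC.
  by apply/funext => x; rewrite exprS.
by case: m => q; [exact: mX|apply: measurable_funVC; exact: mX].
Qed.

Lemma measurable_fun_prodC (I : finType) (F : I -> T -> R[i]) :
  (forall i, measurable_fun setT (F i)) ->
  measurable_fun setT (fun x => \prod_i F i x).
Proof.
move=> mF; elim: (index_enum I) => [|i s IH].
  under eq_fun do rewrite big_nil; exact: measurable_cst.
under eq_fun do rewrite big_cons; exact: measurable_funMC.
Qed.

End complex_measurability.

(* Negative powers are bounded too, since [0^-1 = 0]. *)
Lemma norm_phaseX_le1 {R : realType} (z : R[i]) (m : int) : `|phase z ^ m| <= 1.
Proof.
have [z0|z0] := eqVneq z 0.
  have -> : phase z = 0 by rewrite z0 /phase mul0r.
  by rewrite exp0rz; case: (m == 0); rewrite ?normr1 ?normr0.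
have pz1 : `|phase z| = 1.
  by rewrite /phase normrM normfV normr_id divff ?normr_eq0.
by case: m => q; rewrite /exprz ?normfV normrX pz1 expr1n ?invr1.
Qed.

(** * Coordinate hyperplanes are null for the Gaussian measure *)

Section null_hyperplanes.
Context {R : realType}.

Lemma measurable_setC0 : measurable [set 0 : R[i]].
Proof.
exists ([set 0] `*` [set 0]); first exact: measurableX.
rewrite setTI; apply/seteqP; split => -[a b] /=; last by case=> -> ->.
by case=> /= -> ->.
Qed.

Lemma gaussC_set0 : gaussC (R := R) [set 0] = 0%E.
Proof.
rewrite /gaussC /= /distribution /pushforward.
rewrite (_ : _ @^-1` _ = [set 0] `*` [set 0]); last first.
  apply/seteqP; split => -[a b] /=; first by case=> -> ->.
  by case=> /= -> ->.
rewrite product_measure1E//.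
(* The normal law is absolutely continuous and points are Lebesgue-null. *)
have n0 : normal_prob (0 : R) 1 [set 0] = 0%E.
  have := @normal_prob_dominates R 0 1.
  move/null_content_dominatesP; apply => //.
  exact: lebesgue_measure_set1.
by rewrite [X in (X * _)%E]n0 mul0e.
Qed.

Lemma measurable_coord0 n (i : 'I_n) :
  measurable [set z : dprod (fun _ : 'I_n => R[i]) | z i = 0].
Proof.
have := @measurable_dproj _ _ (fun _ : 'I_n => R[i]) i measurableT
  [set 0] measurable_setC0.
by rewrite setTI.
Qed.

Lemma dprod_prob_coord0 n (i : 'I_n) :
  dprod_prob (fun _ : 'I_n => gaussC (R := R)) [set z | z i = 0] = 0%E.
Proof.
(* The hyperplane is a rectangle, so the product formula applies and its factor at [i] vanishes. *)
pose A j : set R[i] := if j == i then [set 0] else setT.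
rewrite (_ : [set z | _] = [set z | forall j, A j (z j)]); last first.
  apply/seteqP; split => z /= h; last by have := h i; rewrite /A eqxx.
  by move=> j; rewrite /A; case: eqP => // ->.
rewrite dprod_probE => [|j]; last first.
  by rewrite /A; case: ifP => _; [exact: measurable_setC0|exact: measurableT].
rewrite (bigD1 i)//= [X in (X * _)%E](_ : _ = 0%E) ?mul0e//.
by rewrite /A eqxx; exact: gaussC_set0.
Qed.

(** Needed to split off the origin, where [class_of] takes a default value. *)
Lemma measurable_vec0 n :
  measurable [set z : dprod (fun _ : 'I_n => R[i]) | \row_i z i == 0].
Proof.
rewrite (_ : [set z | _] = \bigcap_(i in [set: 'I_n]) [set z | z i = 0]).
  by apply: fin_bigcap_measurable => // i _; exact: measurable_coord0.
apply/seteqP; split => z /=.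
  by move=> /eqP/rowP z0 i _; have := z0 i; rewrite !mxE.
by move=> z0; apply/eqP/rowP => i; rewrite !mxE; exact: z0.
Qed.

End null_hyperplanes.

(** * Homogeneous coordinates and null hyperplanes of projective space *)

Section projective.
Context {R : realType} {n : nat}.

(** The default class at [w = 0] is that of the all-ones vector; covering this case allows preimages
    under [class_of_vec] to be computed on the whole space. *)
Lemma hcoord_class_of (w : 'rV[R[i]]_n.+1) : exists2 c, c != 0 &
  hcoord (class_of w) = c *: (if w == 0 then const_mx 1 else w).
Proof.
have [->|w0] := eqVneq w 0; last exact: class_ofK.
have -> : class_of (0 : 'rV[R[i]]_n.+1) = class_of (const_mx 1).
  congr (\pi_(projspace R n) _); apply: val_inj.
  by rewrite !val_insubd eqxx nzvec1_subproof.
exact: class_ofK (nzvec1_subproof R n).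
Qed.

Lemma fubini_study_hyperplane (i : 'I_n.+1) :
  \forall x \ae fubini_study R n, hcoord x ord0 i != 0.
Proof.
(* The origin drops out because its default class has no vanishing coordinate. *)
have E : (class_of_vec (n := n) (R := R)) @^-1` [set x | hcoord x ord0 i = 0] =
    [set z | z i = 0] `\` [set z | \row_i z i == 0].
  apply/seteqP; split => z /=; rewrite /class_of_vec;
      have [c c0 ->] := hcoord_class_of (\row_i z i); rewrite mxE.
    case: ifPn => [_|z0] /eqP; rewrite mulf_eq0 (negbTE c0) /= mxE.
      by rewrite oner_eq0.
    by move/eqP.
  by move=> [zi /negP/negbTE->]; rewrite mxE zi mulr0.
have mE : measurable ([set z : dprod (fun _ : 'I_n.+1 => R[i]) | z i = 0]
    `\` [set z | \row_i z i == 0]).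
  by apply: measurableD; [exact: measurable_coord0|exact: measurable_vec0].
exists [set x | hcoord x ord0 i = 0]; split.
- by rewrite /measurable /= /image_set_system /= setTI E.
(* [fubini_study] is a pushforward, so the claim reduces to the null Gaussian hyperplane. *)
- transitivity (dprod_prob (fun _ : 'I_n.+1 => gaussC (R := R))
    (class_of_vec (n := n) (R := R) @^-1` [set x | hcoord x ord0 i = 0])) => //.
  rewrite E; apply: (subset_measure0 mE (measurable_coord0 _ i)) => //.
  exact: dprod_prob_coord0.
- by move=> x /= /negP; rewrite negbK => /eqP.
Qed.

End projective.

(** * Phase monomials on a single block *)

Lemma sum_castmx {V : nmodType} m m' (e : m = m') (q : 'rV[V]_m) :
  \sum_i castmx (erefl, e) q ord0 i = \sum_i q ord0 i.
Proof. by case: m' / e; rewrite castmx_id. Qed.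

Section phase_monomial.
Context {R : realType}.

Definition phase_monomial {m} (q : 'rV[int]_m) (v : 'rV[R[i]]_m) : R[i] :=
  \prod_(i < m) phase (v ord0 i) ^ q ord0 i.

Lemma phase_monomialZ m (q : 'rV[int]_m) c (v : 'rV[R[i]]_m) :
  c != 0 -> \sum_i q ord0 i = 0 ->
  phase_monomial q (c *: v) = phase_monomial q v.
Proof.
move=> c0 q0; rewrite /phase_monomial.
under eq_bigr do rewrite mxE phaseM expfzMl.
rewrite big_split /= -[RHS]mul1r; congr (_ * _).
(* The scalar contributes the same phase at every coordinate; its exponents add up because this
   phase is nonzero. *)
transitivity (phase c ^ (\sum_i q ord0 i)); last by rewrite q0 expr0z.
elim/big_rec2: _ => [|i s x _ ->]; first by rewrite expr0z.
by rewrite expfzDr// phase_neq0.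
Qed.

Lemma phase_monomial_cast m m' (e : m = m') (q : 'rV[int]_m)
    (v : 'rV[R[i]]_m) :
  phase_monomial (castmx (erefl, e) q) (castmx (erefl, e) v) =
  phase_monomial q v.
Proof. by case: m' / e; rewrite !castmx_id. Qed.

Lemma norm_phase_monomial_le1 m (q : 'rV[int]_m) (v : 'rV[R[i]]_m) :
  `|phase_monomial q v| <= 1.
Proof.
rewrite normr_prod; apply: prodr_ile1 => i _.
by rewrite normr_ge0 norm_phaseX_le1.
Qed.

(** A set of lines is measurable when its preimage under [class_of_vec] is, so it suffices to work
    on the vector space. There scale invariance replaces the chosen representative by the vector
    itself, except at the origin. *)
Lemma measurable_phase_monomial n (q : 'rV[int]_n.+1) :
  \sum_i q ord0 i = 0 ->
  measurable_fun setT (fun x : projspace R n => phase_monomial q (hcoord x)).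
Proof.
move=> q0 _ B mB; rewrite setTI.
suff mf : measurable_fun setT
    (fun z => phase_monomial q (hcoord (class_of_vec (R := R) (n := n) z))).
  by have := mf measurableT B mB.
rewrite (_ : (fun _ => _) = fun z => if \row_i z i == 0
    then phase_monomial q (const_mx 1) else phase_monomial q (\row_i z i)).
  apply: measurable_fun_ifT.
  - apply: (measurable_fun_bool true); rewrite setTI; exact: measurable_vec0.
  - exact: measurable_cst.
  - apply: measurable_fun_prodC => i.
    apply: measurable_fun_expzC; apply: measurable_fun_phase.
    rewrite [X in measurable_fun _ X](_ : _ = fun z => z i); last first.
      by apply/funext => z; rewrite mxE.
    exact: (@measurable_dproj _ _ (fun _ : 'I_n.+1 => R[i]) i).
apply/funext => z; rewrite /class_of_vec.
by have [c c0 ->] := hcoord_class_of (\row_i z i);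
  rewrite phase_monomialZ//; case: ifP.
Qed.

End phase_monomial.

(** * Descent of the symbol to the product of projective spaces *)

Section symbols.
Context {R : realType} {n l : nat} (k : npartition n l).

Lemma pi_dom_ae : \forall x \ae fubini_study R n, pi_dom k x.
Proof.
apply: filter_forall => j.
(* Blocks are nonempty, so a nonzero first entry suffices; [lift ord0] below skips the coordinate
   [w_0]. *)
pose i0 := Ordinal (Defs.part_gt0 k j).
apply: filterS (fubini_study_hyperplane (lift ord0 (block_index i0))) => x.
apply: contra_neq => /rowP/(_ i0).
by rewrite !mxE.
Qed.

(** The cast matches the length [(k j).-1.+1] of homogeneous coordinates on the [j]-th factor. *)
Definition block_exponent (p : 'rV[int]_n) j : 'rV[int]_(k j).-1.+1 :=
  castmx (erefl, esym (prednK (Defs.part_gt0 k j))) (block k p j).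

Definition descended_symbol (p : 'rV[int]_n)
    (y : dprod (fun j => projspace R (k j).-1)) : R[i] :=
  \prod_j phase_monomial (block_exponent p j) (hcoord (y j)).

Lemma descended_symbolE p x : balanced k p -> pi_dom k x ->
  symbol k p x = descended_symbol p (pi_k k x).
Proof.
move=> bp dx; apply: eq_bigr => j _.
rewrite /pi_k /class_of_pred /block_exponent.
(* Exponents and coordinates are cast along one same equality, so both casts can be removed
   together. *)
move: (esym (prednK _)) => e.
have [|c c0 ->] := class_ofK (w := castmx (erefl, e) (wblock k (hcoord x) j)).
  apply: contra_neq (dx j) => /(congr1 (castmx (esym erefl, esym e))).
  by rewrite castmxK => ->; apply/rowP => i; rewrite castmxE !mxE.
by rewrite phase_monomialZ ?sum_castmx// phase_monomial_cast.
Qed.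

Lemma Linfty_descended_symbol p : balanced k p ->
  Linfty (dprod_prob (fun j => fubini_study R (k j).-1)) (descended_symbol p).
Proof.
move=> bp; split.
  apply: measurable_fun_prodC => j.
  have mj := @measurable_dproj _ _ (fun j => projspace R (k j).-1) j.
  have mq : measurable_fun setT (fun x : projspace R (k j).-1 =>
      phase_monomial (block_exponent p j) (hcoord x)).
    by apply: measurable_phase_monomial; rewrite sum_castmx; exact: bp.
  exact: measurableT_comp mq mj.
have f1 y : Normc.normc (descended_symbol p y) <= 1.
  (* [Normc.normc] is the real-valued form of the norm; embedding the inequality in [R[i]] gives
     access to the lemmas on the complex-valued one. *)
  rewrite -lecR.
  have : `|descended_symbol p y| <= 1; last by [].
  rewrite normr_prod.
  by apply: prodr_ile1 => j _; rewrite normr_ge0 norm_phase_monomial_le1.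
have f0 y : 0 <= Normc.normc (descended_symbol p y).
  rewrite -lecR.
  have : 0 <= `|descended_symbol p y|; last by [].
  exact: normr_ge0.
(* The infinity norm is an essential supremum if the total mass is positive, and 0 otherwise. *)
rewrite unlock; case: ifP => _; last exact: ltry.
apply: (@le_lt_trans _ _ 1%E); last exact: ltry.
by apply/ess_supP; apply: aeW => y /=; rewrite lee_fin ger0_norm.
Qed.

End symbols.

Theorem theorem5p5 (R : realType) (n l : nat) (n_gt0 : (0 < n)%N)
    (l_gt0 : (0 < l)%N) (k : npartition n l) :
  [set symbol (R := R) k p | p in balanced k] `<=` pullback_Linfty (R := R) k.
Proof.
move=> _ [p bp <-]; exists (descended_symbol k p).
  exact: Linfty_descended_symbol.
apply: filterS (pi_dom_ae k) => x dx; split => //.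
exact: descended_symbolE.
Qed.
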